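(* Let $\mu$ be a Borel probability measure on $\mathbb{R}^d$ with bounded support. Then $$\dim_{qA}\operatorname{supp}\mu\leq\dim_{A}\operatorname{supp}\mu\leq\dim_{A}\mu\qquad\text{and}\qquad\dim_{qA}\operatorname{supp}\mu\leq\dim_{qA}\mu\leq\dim_{A}\mu .$$
   Context: $B(x,r)$ denotes the ball of centre $x$ and radius $r$. Dimensions of sets. For a compact set $E\subset\mathbb{R}^d$, $N_r(\cdot)$ denotes the least number of sets of diameter at most $r$ required to cover the given set. For $\delta\geq0$ let $h(\delta)$ be the infimum of all $\alpha$ for which there exist $C_1,C_2>0$ such that for all $0<r\leq R^{1+\delta}\leq R<C_1$, $\sup_{x\in E}N_r(B(x,R)\cap E)\leq C_2(R/r)^\alpha$. The Assouad dimension of $E$ is $\dim_AE=h(0)$ and the quasi-Assouad dimension is $\dim_{qA}E=\lim_{\delta\to0}h(\delta)$. Dimensions of measures. For a Borel probability measure $\mu$ on $\mathbb{R}^d$ and $\delta\geq0$ let $H(\delta)$ be the infimum of all $s$ for which there exist $C_1,C_2>0$ such that for all $0<r\leq R^{1+\delta}\leq R\leq C_1$, $$\sup_{x\in\operatorname{supp}\mu}\frac{\mu(B(x,R))}{\mu(B(x,r))}\leq C_2\left(\frac Rr\right)^s .$$ The Assouad dimension of $\mu$ is $\dim_A\mu=H(0)$ and the quasi-Assouad dimension is $\dim_{qA}\mu=\lim_{\delta\to0}H(\delta)$. All these values lie in $[0,\infty]$. *)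

(* Defs.v *)
From mathcomp Require Import all_boot all_order all_algebra.
From mathcomp Require Import all_classical all_reals all_analysis.

Set Implicit Arguments.
Unset Strict Implicit.
Unset Printing Implicit Defensive.

Import Order.TTheory GRing.Theory Num.Theory.
Import numFieldNormedType.Exports.

Local Open Scope classical_set_scope.
Local Open Scope ring_scope.

(* The library norm on 'rV[R]_d is the sup norm, so the Euclidean distance is
   defined here.  The two norms induce the same topology, hence the same Borel
   sets and the same bounded sets, for which the library notions are used. *)
Definition edist (R : realType) (d : nat) (x y : 'rV[R]_d) : R :=
  Num.sqrt (\sum_(i < d) (x ord0 i - y ord0 i) ^+ 2).

Definition eball (R : realType) (d : nat) (x : 'rV[R]_d) (r : R) :
  set 'rV[R]_d := [set y | edist x y < r].

Definition borelRd (R : realType) (d : nat) :=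
  g_sigma_algebraType (@open 'rV[R]_d).

Definition supp (R : realType) (d : nat) (mu : probability (borelRd R d) R) :
  set 'rV[R]_d :=
  [set x | forall U : set 'rV[R]_d, open U -> U x -> (0 < mu U)%E].

(* The diameter of the empty set is -oo, so it is at most r for every r. *)
Definition diam (R : realType) (d : nat) (F : set 'rV[R]_d) : \bar R :=
  ereal_sup [set (edist u v)%:E | u in F & v in F].

(* Equal to +oo when no finite cover exists. *)
Definition covering_number (R : realType) (d : nat) (r : R)
    (A : set 'rV[R]_d) : \bar R :=
  ereal_inf [set (n%:R : R)%:E | n in
    [set n : nat | exists F : 'I_n -> set 'rV[R]_d,
      (forall i, (diam (F i) <= r%:E)%E) /\ A `<=` \bigcup_i F i]].

Definition assouad_h (R : realType) (d : nat) (E : set 'rV[R]_d) (delta : R) :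
    \bar R :=
  ereal_inf [set alpha%:E | alpha in
    [set alpha : R | exists C1 C2 : R, [/\ 0 < C1, 0 < C2 &
      forall r rho : R,
        0 < r -> r <= rho `^ (1 + delta) -> rho `^ (1 + delta) <= rho ->
        rho < C1 ->
        (ereal_sup [set covering_number r (eball x rho `&` E) | x in E]
          <= (C2 * (rho / r) `^ alpha)%:E)%E]]].

Definition assouad_dim_set (R : realType) (d : nat) (E : set 'rV[R]_d) :
  \bar R := assouad_h E 0.

(* [assouad_h E] is nonincreasing on the nonnegative reals (C1 may be taken at
   most 1), so this limit always exists in \bar R. *)
Definition quasi_assouad_dim_set (R : realType) (d : nat) (E : set 'rV[R]_d) :
  \bar R := lim (assouad_h E delta @[delta --> 0^'+]).

Definition assouad_H (R : realType) (d : nat)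
    (mu : probability (borelRd R d) R) (delta : R) : \bar R :=
  ereal_inf [set s%:E | s in
    [set s : R | exists C1 C2 : R, [/\ 0 < C1, 0 < C2 &
      forall r rho : R,
        0 < r -> r <= rho `^ (1 + delta) -> rho `^ (1 + delta) <= rho ->
        rho <= C1 ->
        (ereal_sup [set mu (eball x rho) / mu (eball x r) | x in supp mu]
          <= (C2 * (rho / r) `^ s)%:E)%E]]].

Definition assouad_dim_measure (R : realType) (d : nat)
    (mu : probability (borelRd R d) R) : \bar R := assouad_H mu 0.

(* As for sets, [assouad_H mu] is nonincreasing, so the limit exists. *)
Definition quasi_assouad_dim_measure (R : realType) (d : nat)
    (mu : probability (borelRd R d) R) : \bar R :=
  lim (assouad_H mu delta @[delta --> 0^'+]).

(* Main.v *)
Require Import Defs.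
From mathcomp Require Import all_boot all_order all_algebra.
From mathcomp Require Import all_classical all_reals all_analysis.
From mathcomp Require Import ring lra.
Import Order.TTheory GRing.Theory Num.Theory.
Import numFieldNormedType.Exports.
Local Open Scope classical_set_scope.
Local Open Scope ring_scope.
(** At each fixed delta, every exponent admissible for mu is admissible for
    supp mu.  If c_1, ..., c_n are r/2-separated points of B(x, rho) in supp mu,
    the balls B(c_i, r/4) are disjoint subsets of B(x, 2 rho), which lies in every
    B(c_i, 3 rho); comparing mu(B(c_i, 3 rho)) with mu(B(c_i, r/4)) gives
    n <= C2 (12 rho / r)^s.  A maximal such family covers by balls of diameter at
    most r.  The quasi-Assouad dimensions follow since both h and H are
    nonincreasing in delta. *)

Local Notation edist := Defs.edist.

Set Implicit Arguments.
Unset Strict Implicit.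
Unset Printing Implicit Defensive.

(** * Euclidean geometry, Borel balls, and covering numbers bounded by packings *)

Section EuclideanDistance.
Variables (R : realType) (d : nat).
Implicit Types x y z : 'rV[R]_d.

Lemma edistC x y : edist x y = edist y x.
Proof.
by congr Num.sqrt; apply: eq_bigr => i _; rewrite -sqrrN opprB.
Qed.

Lemma edist_ge0 x y : 0 <= edist x y. Proof. exact: sqrtr_ge0. Qed.

Lemma edistxx x : edist x x = 0.
Proof. by rewrite /edist big1 ?sqrtr0// => i _; rewrite subrr expr0n. Qed.

Lemma cauchy_schwarz (I : finType) (a b : I -> R) :
  \sum_i a i * b i <=
  Num.sqrt (\sum_i a i ^+ 2) * Num.sqrt (\sum_i b i ^+ 2).
Proof.
set A := \sum_i a i ^+ 2; set B := \sum_i b i ^+ 2; set C := \sum_i a i * b i.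
have A0 : 0 <= A by apply: sumr_ge0 => i _; exact: sqr_ge0.
have B0 : 0 <= B by apply: sumr_ge0 => i _; exact: sqr_ge0.
suff CAB : C ^+ 2 <= A * B.
  by rewrite -sqrtrM// (le_trans (ler_norm _))// -sqrtr_sqr ler_sqrt// mulr_ge0.
(* Nonnegativity of this sum of squares gives C ^+ 2 <= A * B once B > 0 is cancelled; if B = 0,
   every b i vanishes. *)
have expand : \sum_i (B * a i - C * b i) ^+ 2 = B * (A * B - C ^+ 2).
  rewrite (eq_bigr (fun i => B ^+ 2 * a i ^+ 2 + - (2 * B * C) * (a i * b i)
    + C ^+ 2 * b i ^+ 2)); last by move=> i _; ring.
  by rewrite !big_split/= -!mulr_sumr -/A -/B -/C; ring.
have := B0; rewrite le_eqVlt => /predU1P[B_eq0|B_gt0].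
  have b_eq0 i : b i = 0.
    have := psumr_eq0P (fun i _ => sqr_ge0 (b i)) (esym B_eq0) (i:=i) isT.
    by move/eqP; rewrite sqrf_eq0 => /eqP.
  by rewrite /C big1 ?expr0n ?mulr_ge0// => i _; rewrite b_eq0 mulr0.
rewrite -subr_ge0 -(pmulr_rge0 _ B_gt0) -expand.
by apply: sumr_ge0 => i _; exact: sqr_ge0.
Qed.

Lemma edist_triangle y x z : edist x z <= edist x y + edist y z.
Proof.
have sq_ge0 (u v : 'rV[R]_d) : 0 <= \sum_(i < d) (u ord0 i - v ord0 i) ^+ 2.
  by apply: sumr_ge0 => i _; exact: sqr_ge0.
rewrite -(ler_pXn2r (n:=2))// ?nnegrE ?addr_ge0 ?edist_ge0//.
rewrite sqrrD /edist !sqr_sqrtr//.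
(* Splitting x - z as (x - y) + (y - z) makes the square terms cancel; the cross term is left to
   Cauchy-Schwarz. *)
rewrite (eq_bigr (fun i : 'I_d => (x ord0 i - y ord0 i) ^+ 2
   + ((x ord0 i - y ord0 i) * (y ord0 i - z ord0 i)) *+ 2
   + (y ord0 i - z ord0 i) ^+ 2)); last first.
  by move=> i _; ring.
rewrite !big_split/= lerD2r lerD2l -mulr2n lerMn2r/=.
exact: cauchy_schwarz.
Qed.

Lemma eball_sub x y (r s : R) : edist y x + r <= s -> eball x r `<=` eball y s.
Proof.
move=> rs z; rewrite /eball/= => xz.
by rewrite (le_lt_trans (edist_triangle x _ _))// (lt_le_trans _ rs)// ltrD2l.
Qed.

Lemma eball_center x (r : R) : 0 < r -> eball x r x.
Proof. by rewrite /eball/= edistxx. Qed.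

Lemma diam_eball x (r : R) : (diam (eball x (r / 2)) <= r%:E)%E.
Proof.
apply: ge_ereal_sup => _ [u xu [v xv <-]]; rewrite lee_fin.
rewrite (le_trans (edist_triangle x _ _))// edistC [leRHS](splitr r).
by rewrite lerD// ltW.
Qed.

(** Continuity is for the sup-norm topology of the library; it makes Euclidean balls open there,
    hence measurable in [borelRd]. *)
Lemma edist_continuous x : continuous (edist x).
Proof.
move=> y; apply: continuous_comp; last exact: sqrt_continuous.
apply: (@cvg_big _ _ _ _ _ (@add_continuous _) _ (nbhs y)) => i _.
apply: (@continuous_comp _ R R (fun z => x ord0 i - z ord0 i)
  (fun t : R => t ^+ 2) y); last exact: exprn_continuous.
by apply: continuousB; [exact: cst_continuous|exact: coord_continuous].
Qed.

Lemma open_eball x (r : R) : open (eball x r).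
Proof.
apply: (open_comp (f := edist x) (D := [set t | t < r])); last exact: open_lt.
by move=> y _; exact: edist_continuous.
Qed.

Lemma measurable_eball x (r : R) :
  measurable (eball x r : set (borelRd R d)).
Proof. by apply: sub_sigma_algebra; exact: open_eball. Qed.

(* A maximal r/2-separated family in A is the set of centres of a cover of A by
   balls of radius r/2. *)
Lemma covering_number_le_packing (A : set 'rV[R]_d) (r K : R) : 0 < r ->
  (forall n (c : 'I_n -> 'rV[R]_d), (forall i, A (c i)) ->
    (forall i j, i != j -> r / 2 <= edist (c i) (c j)) -> n%:R <= K) ->
  (covering_number r A <= K%:E)%E.
Proof.
move=> r0 packing.
pose separated n := `[< exists c : 'I_n -> 'rV[R]_d, (forall i, A (c i)) /\
  forall i j, i != j -> r / 2 <= edist (c i) (c j) >].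
have separated0 : exists n, separated n.
  exists 0%N; apply/asboolP; exists (fun=> 0).
  by split; case.
have bounded n : separated n -> (n <= Num.bound K)%N.
  move=> /asboolP[c [Ac cs]]; rewrite -(ler_nat R).
  have n_le := packing n c Ac cs.
  by rewrite (le_trans n_le)// ltW// archi_boundP// (le_trans _ n_le).
case: (ex_maxnP separated0 bounded) => n /asboolP[c [Ac cs]] n_max.
apply: (@le_trans _ _ (n%:R)%:E); last by rewrite lee_fin; exact: packing Ac cs.
apply: ereal_inf_lbound; exists n => //.
exists (fun i => eball (c i) (r / 2)); split=> [i|y Ay]; first exact: diam_eball.
apply: contrapT => y_far.
suff /n_max : separated n.+1 by rewrite ltnn.
have far i : r / 2 <= edist (c i) y.
  by rewrite leNgt; apply/negP => cy; apply: y_far; exists i.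
(* An uncovered y is at distance at least r / 2 from every centre; placed at the last index, it
   extends the maximal family. *)
apply/asboolP; exists (fun i => if unlift ord_max i is Some j then c j else y).
split=> [i|i j]; first by case: unliftP.
case: unliftP => [i' ->|->]; case: unliftP => [j' ->|->] //.
- by rewrite (inj_eq lift_inj); exact: cs.
- by rewrite edistC.
- by rewrite eqxx.
Qed.

End EuclideanDistance.

(** For rho <= 1, powers of rho decrease with the exponent. For rho > 1 they increase, and both
    bounds follow by passing through rho. As all rho are covered, C1 and C2 can be kept when delta
    grows. *)
Lemma scale_range_le (R : realType) (delta1 delta2 r rho : R) :
  0 <= delta1 <= delta2 -> 0 < r ->
  r <= rho `^ (1 + delta2) -> rho `^ (1 + delta2) <= rho ->
  r <= rho `^ (1 + delta1) /\ rho `^ (1 + delta1) <= rho.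
Proof.
move=> /andP[delta10 delta12] r0 r_le rho_le.
have rho0 : 0 < rho by rewrite (lt_le_trans r0)// (le_trans r_le).
have [rho1|/ltW rho1] := leP rho 1.
  have rho01 : 0 < rho <= 1 by rewrite rho0.
  split; last by rewrite ge1r_powR// lerDl.
  apply: (le_trans r_le); rewrite /powR gt_eqF// ler_expR.
  by rewrite ler_wnM2r ?ln_le0// lerD2l.
split; first by rewrite (le_trans r_le)// (le_trans rho_le)// le1r_powR// lerDl.
by rewrite (le_trans _ rho_le)// ler_powR// lerD2l.
Qed.

(** * Monotonicity in delta and comparison of h with H *)

Section Exponents.
Variables (R : realType) (d : nat).

Lemma assouad_h_nonincreasing (E : set 'rV[R]_d) (delta1 delta2 : R) :
  0 <= delta1 <= delta2 -> (assouad_h E delta2 <= assouad_h E delta1)%E.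
Proof.
move=> delta12; apply: ereal_inf_le_tmp => _ [alpha [C1 [C2 [C10 C20 bound]]] <-].
exists alpha => //; exists C1, C2; split=> // r rho r0 r_le rho_le rho_lt.
by have [? ?] := scale_range_le delta12 r0 r_le rho_le; exact: bound.
Qed.

Lemma assouad_H_nonincreasing (mu : probability (borelRd R d) R)
    (delta1 delta2 : R) :
  0 <= delta1 <= delta2 -> (assouad_H mu delta2 <= assouad_H mu delta1)%E.
Proof.
move=> delta12; apply: ereal_inf_le_tmp => _ [s [C1 [C2 [C10 C20 bound]]] <-].
exists s => //; exists C1, C2; split=> // r rho r0 r_le rho_le rho_C1.
by have [? ?] := scale_range_le delta12 r0 r_le rho_le; exact: bound.
Qed.

(** With B the ball of radius 2 rho about x, summing over i gives n mu(B) <= K mu(B). Since x lies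
    in the support, mu(B) > 0 can be cancelled. *)
Lemma packing_measure (mu : probability (borelRd R d) R) n
    (c : 'I_n -> 'rV[R]_d) (x : 'rV[R]_d) (r rho K : R) :
  supp mu x -> 0 < rho -> r <= rho -> 0 <= K ->
  (forall i, eball x rho (c i)) ->
  (forall i j, i != j -> r / 2 <= edist (c i) (c j)) ->
  (forall i, mu (eball (c i) (3 * rho)) <= K%:E * mu (eball (c i) (r / 4)))%E ->
  n%:R <= K.
Proof.
move=> x_supp rho0 r_rho K0 xc sep doubling.
have muE y s : mu (eball y s) = (fine (mu (eball y s)))%:E.
  by rewrite fineK// fin_num_measure//; exact: measurable_eball.
pose B := eball x (2 * rho).
have B_gt0 : 0 < fine (mu B).
  rewrite -lte_fin -muE; apply: x_supp; first exact: open_eball.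
  by apply: eball_center; rewrite mulr_gt0.
(* A common point would put two centres at distance less than r / 4 + r / 4. *)
have disjoint : trivIset setT (fun i => eball (c i) (r / 4)).
  move=> i j _ _ [z [iz jz]]; apply/eqP/negPn/negP => /sep.
  rewrite leNgt => /negP; apply.
  rewrite (le_lt_trans (edist_triangle z _ _))//.
  by move: iz jz; rewrite /eball/= (edistC z); lra.
have sum_le : \sum_(i < n) fine (mu (eball (c i) (r / 4))) <= fine (mu B).
  rewrite -lee_fin -sumEFin -muE.
  under eq_bigr do rewrite -muE.
  rewrite -measure_bigsetU_ord//; last by move=> i; exact: measurable_eball.
  apply: le_measure; rewrite ?inE.
  - by apply: bigsetU_measurable => i _; exact: measurable_eball.
  - exact: measurable_eball.
  - rewrite -(bigcup_pred predT) => z [i _]; apply: eball_sub.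
    by have := xc i; rewrite /eball/=; lra.
have B_le i : fine (mu B) <= K * fine (mu (eball (c i) (r / 4))).
  rewrite -lee_fin EFinM -!muE (le_trans _ (doubling i))//.
  apply: le_measure; rewrite ?inE; [exact: measurable_eball..|].
  by apply: eball_sub; have := xc i; rewrite /eball/= edistC; lra.
rewrite -(ler_pM2r B_gt0) (le_trans _ (ler_wpM2l K0 sum_le))//.
rewrite mulr_sumr -[n in n%:R]card_ord -sum1_card natr_sum mulr_suml.
by apply: ler_sum => i _; rewrite mul1r.
Qed.

Lemma assouad_h_le_H (mu : probability (borelRd R d) R) (delta : R) :
  0 <= delta -> (assouad_h (supp mu) delta <= assouad_H mu delta)%E.
Proof.
move=> delta0; apply: ereal_inf_le_tmp => _ [s [C1 [C2 [C10 C20 bound]]] <-].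
exists s => //; exists (Num.min C1 1 / 3), (C2 * 12 `^ s).
have min_gt0 : 0 < Num.min C1 1 by rewrite lt_min C10 ltr01.
split; [by rewrite divr_gt0|by rewrite mulr_gt0 ?powR_gt0|].
move=> r rho r0 r_le rho_le; rewrite ltr_pdivlMr// mulrC lt_min.
move=> /andP[/ltW rho_C1 /ltW rho_1].
have r_rho : r <= rho := le_trans r_le rho_le.
have rho0 : 0 < rho := lt_le_trans r0 r_rho.
apply: ge_ereal_sup => _ [x x_supp <-].
apply: covering_number_le_packing => // n c xc sep.
apply: (@packing_measure mu n c x r rho) => //.
- by rewrite mulr_ge0 ?powR_ge0// mulr_ge0 ?powR_ge0// ltW.
- by move=> i; case: (xc i).
move=> i; have [_ ci_supp] := xc i.
(* The quotient in [assouad_H] is one of extended reals; it can be multiplied out because its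
   denominator is positive and finite. *)
have small_gt0 : (0 < mu (eball (c i) (r / 4)))%E.
  by apply: ci_supp; [exact: open_eball|apply: eball_center; rewrite divr_gt0].
have small_fin : mu (eball (c i) (r / 4)) = (fine (mu (eball (c i) (r / 4))))%:E.
  by rewrite fineK// fin_num_measure//; exact: measurable_eball.
rewrite small_fin -lee_pdivrMr; last by rewrite -lte_fin -small_fin.
have -> : C2 * 12 `^ s * (rho / r) `^ s = C2 * (3 * rho / (r / 4)) `^ s.
  rewrite -mulrA -powRM ?divr_ge0 ?ltW//; congr (_ * _ `^ _).
  by field; rewrite gt_eqF.
have rho3_gt0 : 0 < 3 * rho by rewrite mulr_gt0.
have rho3_le : (3 * rho) `^ (1 + delta) <= 3 * rho.
  by rewrite ge1r_powR ?rho3_gt0 ?lerDl.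
have r4_le : r / 4 <= (3 * rho) `^ (1 + delta).
  apply: (@le_trans _ _ r); first by lra.
  by rewrite (le_trans r_le)// ge0_ler_powR ?nnegrE ?addr_ge0//; lra.
apply: le_trans (bound _ _ _ r4_le rho3_le rho_C1); last by rewrite divr_gt0.
apply: ereal_sup_ubound; exists (c i) => //.
by rewrite {1}small_fin inver gt_eqF// -lte_fin -small_fin.
Qed.

End Exponents.

(** * Right limits at 0 of nonincreasing functions *)

Section RightLimits.
Variable R : realType.
Implicit Types f g : R -> \bar R.

Let nonincr f := forall x y : R, 0 <= x <= y -> (f y <= f x)%E.

Lemma nonincreasing_is_cvg_at_right0 f : nonincr f -> cvg (f x @[x --> 0^'+]).
Proof.
move=> f_ni; apply/cvg_ex; eexists.
(* The limit, left to unification, is the supremum of f over the positive reals. *)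
apply: (@nonincreasing_at_right_cvge R f 0 +oo%O) => // x y.
by rewrite !in_itv/= !andbT => /ltW x0 _ xy; apply: f_ni; rewrite x0.
Qed.

Lemma nonincreasing_lim_at_right0_le f :
  nonincr f -> (lim (f x @[x --> 0^'+]) <= f 0%R)%E.
Proof.
move=> f_ni; apply: lime_le; first exact: nonincreasing_is_cvg_at_right0.
near=> x; apply: f_ni; rewrite lexx/=; near: x; exact: nbhs_right_ge.
Unshelve. all: end_near. Qed.

Lemma nonincreasing_lim_at_right0_homo f g : nonincr f -> nonincr g ->
  (forall x, 0 <= x -> (f x <= g x)%E) ->
  (lim (f x @[x --> 0^'+]) <= lim (g x @[x --> 0^'+]))%E.
Proof.
move=> f_ni g_ni fg.
apply: lee_lim; [exact: nonincreasing_is_cvg_at_right0..|].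
near=> x; apply: fg; near: x; exact: nbhs_right_ge.
Unshelve. all: end_near. Qed.

End RightLimits.

Theorem proposition2p2 (R : realType) (d : nat)
    (mu : probability (borelRd R d) R)
    (supp_bounded : bounded_set (supp mu)) :
  ((quasi_assouad_dim_set (supp mu) <= assouad_dim_set (supp mu)
      <= assouad_dim_measure mu)%E) /\
  ((quasi_assouad_dim_set (supp mu) <= quasi_assouad_dim_measure mu
      <= assouad_dim_measure mu)%E).
Proof.
have h_ni := @assouad_h_nonincreasing R d (supp mu).
have H_ni := @assouad_H_nonincreasing R d mu.
split; apply/andP; split.
(* Both Assouad dimensions are by definition the values at delta = 0. *)
- exact: nonincreasing_lim_at_right0_le.
- exact: assouad_h_le_H.
- by apply: nonincreasing_lim_at_right0_homo => // delta; exact: assouad_h_le_H.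
- exact: nonincreasing_lim_at_right0_le.
Qed.
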